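(* Let $R$ be a right hereditary ring. Then the following are equivalent. (1) $R$ is right max-$QF$. (2) Every simple injective right $R$-module is projective. (3) Every singular injective right $R$-module is $R$-projective. (4) Every singular injective right $R$-module is max-projective. (5) $\operatorname{Rad}(E)=E$ for every singular injective right $R$-module $E$. (6) Every injective right $R$-module $E$ can be decomposed as $E=Z(E)\oplus F$ for some submodule $F$ of $E$, with $\operatorname{Rad}(Z(E))=Z(E)$.
   Context: Rings are associative with identity; modules are unital right modules. A right $R$-module $M$ is $R$-projective if for every right ideal $I$ of $R$, every homomorphism $M\to R/I$ factors through the canonical projection $R\to R/I$. $M$ is max-projective if for every maximal right ideal $I$ of $R$, every homomorphism $M\to R/I$ factors through the canonical projection $R\to R/I$. $R$ is right max-$QF$ if every injective right $R$-module is max-projective. $Z(M)$ denotes the singular submodule of $M$ (elements whose annihilator is an essential right ideal); $M$ is singular if $Z(M)=M$. $\operatorname{Rad}(M)$ is the Jacobson radical of $M$ (the intersection of all maximal submodules, equal to $M$ if there are none). *)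

(* Defs.v *)
From HB Require Import structures.
From mathcomp Require Import all_boot all_order all_algebra.
From mathcomp Require Import boolp.

Set Implicit Arguments.
Unset Strict Implicit.
Unset Printing Implicit Defensive.

Import GRing.Theory.
Local Open Scope ring_scope.
Local Open Scope quotient_scope.

(* MathComp modules are left modules, so right modules over R are the modules
   over the converse ring R^c (x r is written r *: x).  The notions below are
   stated for modules over an arbitrary ring A; taking A := R^c gives the
   right-handed versions, and in particular the submodules of the regular
   module R^c^o are exactly the right ideals of R. *)
Notation rmodType R := (lmodType R^c).

(* Submodules are the bundled predicates [N : submodClosed V]; since the
   predicates are boolean, Prop-valued ones enter through [asbool].  All
   submodules, right ideals and maximal ones are covered, thanks to the
   classical axioms of boolp. *)
Section SubmoduleOfProp.
Variables (A : pzRingType) (V : lmodType A) (P : V -> Prop).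

Definition submod_pred (x : V) : bool := `[< P x >].

Lemma submod_pred_closed :
  P 0 -> (forall x y, P x -> P y -> P (x + y)) ->
  (forall a x, P x -> P (a *: x)) -> subsemimod_closed submod_pred.
Proof.
move=> P0 PD PZ; split; first split; first exact/asboolP.
  by move=> x y /asboolP Px /asboolP Py; apply/asboolP/PD.
by move=> a x /asboolP Px; apply/asboolP/PZ.
Qed.

Lemma submod_of_propP :
  P 0 -> (forall x y, P x -> P y -> P (x + y)) ->
  (forall a x, P x -> P (a *: x)) ->
  exists N : submodClosed V, forall x, x \in N <-> P x.
Proof.
move=> P0 PD PZ; have c := submod_pred_closed P0 PD PZ.
pose m := GRing.isSubmodClosed.Build A V submod_pred c.
pose N : submodClosed V := HB.pack submod_pred m.
by exists N => x; split=> [/asboolP|Px]; last apply/asboolP.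
Qed.

End SubmoduleOfProp.

Section SubmoduleAsModule.
Variables (A : pzRingType) (V : lmodType A) (N : submodClosed V).

Lemma submod_closed_zmod : zmod_closed N.
Proof.
split=> [|x y Nx Ny]; first exact: rpred0.
by rewrite rpredD // -scaleN1r rpredZ.
Qed.

Record submod := Submod { submod_val : V; submod_valP : submod_val \in N }.

HB.instance Definition _ := [isSub for submod_val].
HB.instance Definition _ := [Choice of submod by <:].
HB.instance Definition _ := [SubChoice_isSubLmodule of submod by <:].

Definition submod_zmod : zmodClosed V :=
  HB.pack (GRing.SubmodClosed.sort N)
    (GRing.isZmodClosed.Build V (GRing.SubmodClosed.sort N) submod_closed_zmod).

(* The projection V -> V / N is [\pi_(quotmod N)]. *)
Definition quotmod := Quotient.quot submod_zmod.

HB.instance Definition _ := ZmodQuotient.on quotmod.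

Definition quotmod_scale (a : A) : quotmod -> quotmod :=
  lift_op1 quotmod ( *:%R a).

Lemma pi_scale a : {morph \pi_quotmod : x / a *: x >-> quotmod_scale a x}.
Proof.
move=> x; unlock quotmod_scale; apply/eqP.
rewrite -Quotient.idealrBE -scalerBr.
apply: (rpredZ (s := N)).
by have: (x - repr (\pi_quotmod x)) \in submod_zmod
  by rewrite Quotient.idealrBE reprK.
Qed.

Canonical pi_scale_morph a := PiMorph1 (pi_scale a).

Fact quotmod_scalerA a b x :
  quotmod_scale a (quotmod_scale b x) = quotmod_scale (a * b) x.
Proof. by rewrite -[x]reprK !piE scalerA. Qed.
Fact quotmod_scale1r : left_id 1 quotmod_scale.
Proof. by move=> x; rewrite -[x]reprK !piE scale1r. Qed.
Fact quotmod_scalerDr : right_distributive quotmod_scale +%R.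
Proof. by move=> a x y; rewrite -[x]reprK -[y]reprK !piE scalerDr. Qed.
Fact quotmod_scalerDl x : {morph quotmod_scale^~ x : a b / a + b}.
Proof. by move=> a b; rewrite -[x]reprK !piE scalerDl. Qed.

HB.instance Definition _ := GRing.Zmodule_isLmodule.Build A quotmod
  quotmod_scalerA quotmod_scale1r quotmod_scalerDr quotmod_scalerDl.

HB.instance Definition _ :=
  GRing.isScalable.Build A V quotmod *:%R \pi_quotmod pi_scale.

Fact pi_quotmod_eq0 x : (\pi_quotmod x == 0 :> quotmod) = (x \in N).
Proof.
have -> : x \in N = (x - 0 \in submod_zmod) by rewrite subr0.
by rewrite Quotient.idealrBE raddf0.
Qed.

End SubmoduleAsModule.

Section SubmoduleLattice.
Variables (A : pzRingType) (V : lmodType A).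

Definition maximal_submod (N : submodClosed V) : Prop :=
  ~ (N =i predT) /\
  forall P : submodClosed V, {subset N <= P} -> P =i N \/ P =i predT.

Definition essential_submod (N : submodClosed V) : Prop :=
  forall P : submodClosed V,
    (forall x, x \in N -> x \in P -> x = 0) -> forall x, x \in P -> x = 0.

Definition internal_direct_sum (N P : submodClosed V) : Prop :=
  (forall x, exists y z, [/\ y \in N, z \in P & x = y + z]) /\
  (forall x, x \in N -> x \in P -> x = 0).

(* The Jacobson radical; it is the whole of V when V has no maximal submodule *)
Definition jacobson_rad : {pred V} :=
  [pred x | `[< forall N : submodClosed V, maximal_submod N -> x \in N >]].

End SubmoduleLattice.

Arguments jacobson_rad {A} V.

Section Annihilator.
Variables (A : pzRingType) (V : lmodType A) (x : V).

Definition annihilator_pred (a : A^o) : bool := (a : A) *: x == 0.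

Fact annihilator_closed : subsemimod_closed annihilator_pred.
Proof.
split; first split; first by rewrite unfold_in scale0r.
  move=> a b; rewrite !unfold_in /annihilator_pred => /eqP a0 /eqP b0.
  by rewrite scalerDl a0 b0 addr0.
move=> a b; rewrite !unfold_in /annihilator_pred => /eqP b0.
have -> : ((a *: b : A^o) : A) *: x = a *: ((b : A) *: x) by rewrite scalerA.
by rewrite b0 scaler0.
Qed.

HB.instance Definition _ :=
  GRing.isSubmodClosed.Build A A^o annihilator_pred annihilator_closed.

Definition annihilator : submodClosed A^o :=
  GRing.SubmodClosed.clone A A^o annihilator_pred _.

End Annihilator.

Section Singular.
Variables (A : pzRingType) (V : lmodType A).

Definition singular_pred (x : V) : bool :=
  `[< essential_submod (annihilator x) >].

Fact singular_closed : subsemimod_closed singular_pred.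
Proof.
apply: submod_pred_closed => [P IP a Pa|x y Ex Ey P IP|b x Ex P IP].
- by apply: IP => //; rewrite unfold_in /annihilator_pred scaler0.
- have [Q QP] : exists Q : submodClosed A^o,
    forall a, a \in Q <-> a \in P /\ a \in annihilator x.
    by apply: submod_of_propP => [|a b [? ?] [? ?]|a b [? ?]];
      split; rewrite ?rpred0 ?rpredD ?rpredZ.
  have Q0 a : a \in Q -> a = 0.
    apply: Ey => {}a ya /QP[Pa xa]; apply: IP => //.
    move: xa ya; rewrite !unfold_in /annihilator_pred => /eqP xa /eqP ya.
    by rewrite scalerDr xa ya addr0.
  by apply: Ex => a xa Pa; apply/Q0/QP.
have [Q QP] : exists Q : submodClosed A^o,
    forall a, a \in Q <-> exists2 c : A^o, c \in P & a = (c : A) * b.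
  apply: submod_of_propP => [|_ _ [c Pc ->] [d Pd ->]|a _ [c Pc ->]].
  - by exists 0; rewrite ?rpred0 ?mul0r.
  - by exists (c + d); rewrite ?rpredD ?mulrDl.
  - by exists (a *: c); rewrite ?rpredZ //; apply: mulrA.
have annE c : (c : A) * b \in annihilator x -> c \in annihilator (b *: x).
  by rewrite !unfold_in /annihilator_pred scalerA.
have Q0 a : a \in Q -> a = 0.
  apply: Ex => {}a xa /QP[c Pc def_a].
  have c0: c = 0 by apply: IP => //; apply: annE; rewrite -def_a.
  by rewrite def_a c0 mul0r.
move=> c Pc; apply: IP => //; apply: annE.
by rewrite (Q0 (_ * _)) ?rpred0 //; apply/QP; exists c.
Qed.

HB.instance Definition _ :=
  GRing.isSubmodClosed.Build A V singular_pred singular_closed.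

Definition singular_submod : submodClosed V :=
  GRing.SubmodClosed.clone A V singular_pred _.

End Singular.

Arguments singular_submod {A} V.

Section ModuleClasses.
Variables (A : pzRingType) (M : lmodType A).

Definition injective_module : Prop :=
  forall (U V : lmodType A) (i : {linear U -> V}) (f : {linear U -> M}),
    injective i -> exists g : {linear V -> M}, forall u, g (i u) = f u.

Definition projective_module : Prop :=
  forall (U V : lmodType A) (p : {linear U -> V}) (f : {linear M -> V}),
    (forall v, exists u, p u = v) ->
    exists g : {linear M -> U}, forall x, p (g x) = f x.

Definition simple_module : Prop :=
  (exists x : M, x != 0) /\
  forall N : submodClosed M, N =i pred1 0 \/ N =i predT.

Definition singular_module : Prop := singular_submod M =i predT.

Definition lifts_mod (I : submodClosed A^o) : Prop :=
  forall f : {linear M -> quotmod I},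
    exists g : {linear M -> A^o}, forall x, f x = \pi_(quotmod I) (g x).

(* With A := R^c this is R-projectivity of a right R-module. *)
Definition ring_projective : Prop :=
  forall I : submodClosed A^o, lifts_mod I.

Definition max_projective : Prop :=
  forall I : submodClosed A^o, maximal_submod I -> lifts_mod I.

End ModuleClasses.

Definition right_hereditary (R : pzRingType) : Prop :=
  forall I : submodClosed R^c^o, projective_module (submod I).

Definition right_max_QF (R : pzRingType) : Prop :=
  forall E : rmodType R, injective_module E -> max_projective E.

(* Main.v *)
From HB Require Import structures.
Require Import Defs.
From mathcomp Require Import all_boot all_order all_algebra.
From mathcomp Require Import boolp classical_sets.

Set Implicit Arguments.
Unset Strict Implicit.
Unset Printing Implicit Defensive.

Import GRing.Theory.
Local Open Scope ring_scope.
Local Open Scope quotient_scope.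

(** The implications run around the cycle.  Heredity enters through two of its
consequences: quotients of injective modules are injective (lift
maps defined on an ideal from the quotient to the injective module, by
projectivity of the ideal, and conclude with Baer's criterion), and the ring
is nonsingular (an element whose principal ideal is projective has a direct
summand of the ring as annihilator, and a proper summand is not essential).

- (1) to (2): an injective simple module S is isomorphic to R/I with I maximal;
  lifting this isomorphism to R embeds S as a summand of R.
- (2) to (3): a nonzero map from a singular injective module E onto a simple
  module would make that module injective, singular and projective, but a
  nonzero singular module does not embed in a nonsingular ring.  So E has full radical.
  Then every map from E to R/I vanishes: its image is injective, hence a summand
  of R/I, hence cyclic, and a nonzero cyclic module has a simple quotient.
- (4) to (5): if E is not equal to its radical it has a nonzero map to a simple
  module; lifting it to R gives a nonzero map from a singular module to R.
- (5) to (6): over a nonsingular ring Z(E) is closed in E, hence a summand of an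
  injective E, hence injective, and (5) applies to it.
- (6) to (1): let f map E to R/I with I maximal.  If I is not essential it is
  a summand of R and R/I is projective.  If I is essential and f is nonzero,
  then R/I is a singular injective simple module, which (6) forbids since the radical
  of a simple module is zero.

The maximal ideals, the maximal partial extension in Baer's criterion and the
complement of Z(E) are all submodules maximal for avoiding some set; the lemma
[maximal_avoiding] provides the three of them.

All results but the theorem itself are stated for left modules over a ring A, of
which right modules over R are the instance A := R^c. *)

(** * Linear maps and submodules *)

Section LinearMaps.
Variable A : pzRingType.
Implicit Types U V W : lmodType A.

Lemma submodB V (N : submodClosed V) x y :
  x \in N -> y \in N -> x - y \in N.
Proof. exact: (submod_closed_zmod N).2. Qed.

(** Existential form of the packing of a linear function, convenient inside
proofs, where no instance can be declared. *)
Lemma linear_of_fun U V (f : U -> V) :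
  linear f -> exists g : {linear U -> V}, g =1 f.
Proof.
move=> lf; pose m := GRing.isLinear.Build A U V *:%R f lf.
pose g : {linear U -> V} := HB.pack f m.
by exists g.
Qed.

Lemma orbit_map V (x : V) :
  exists r : {linear A^o -> V}, forall a : A, r a = a *: x.
Proof.
have [|r rE] := @linear_of_fun A^o V (fun a : A^o => (a : A) *: x).
  by move=> a b c /=; rewrite scalerDl scalerA.
by exists r.
Qed.

Lemma factor_through_surjection U V W (p : {linear U -> V})
    (f : {linear U -> W}) :
  (forall v, exists u, p u = v) -> (forall u, p u = 0 -> f u = 0) ->
  exists g : {linear V -> W}, forall u, g (p u) = f u.
Proof.
move=> /choice[s sK] kerpf.
have fE u u' : p u = p u' -> f u = f u'.
  by move=> e; apply/eqP; rewrite -subr_eq0 -linearB kerpf ?linearB ?e ?subrr.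
have [|g gE] := @linear_of_fun V W (f \o s).
  by move=> a v v' /=; rewrite -linearP; apply: fE; rewrite linearP !sK.
by exists g => u; rewrite gE; apply: fE; rewrite sK.
Qed.

Lemma corestrict U V (N : submodClosed V) (f : {linear U -> V}) :
  (forall u, f u \in N) ->
  exists g : {linear U -> submod N}, forall u, val (g u) = f u.
Proof.
move=> fN; have [|g gE] := @linear_of_fun U (submod N) (fun u => Submod (fN u)).
  by move=> a u v; apply: val_inj; rewrite [RHS]linearP; apply: linearP.
by exists g => u; rewrite gE.
Qed.

Lemma image_submod U V (f : {linear U -> V}) (P : submodClosed U) :
  exists N : submodClosed V, forall v, v \in N <-> exists2 u, u \in P & f u = v.
Proof.
apply: submod_of_propP => [|_ _ [u Pu <-] [w Pw <-]|a _ [u Pu <-]].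
- by exists 0; rewrite ?rpred0 ?linear0.
- by exists (u + w); rewrite ?rpredD ?linearD.
- by exists (a *: u); rewrite ?rpredZ ?linearZ.
Qed.

Lemma preimage_submod U V (f : {linear U -> V}) (P : submodClosed V) :
  exists N : submodClosed U, forall u, u \in N <-> f u \in P.
Proof.
apply: submod_of_propP => [|u w fu fw|a u fu]; first by rewrite linear0 rpred0.
  by rewrite linearD rpredD.
by rewrite linearZ rpredZ.
Qed.

Lemma ker_submod U V (f : {linear U -> V}) :
  exists N : submodClosed U, forall u, u \in N <-> f u = 0.
Proof.
apply: submod_of_propP => [|u w fu fw|a u fu]; first exact: linear0.
  by rewrite linearD fu fw addr0.
by rewrite linearZ /= fu scaler0.
Qed.

Lemma full_submod V : exists N : submodClosed V, N =i predT.
Proof.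
have [//|//|//|N NE] := @submod_of_propP A V (fun=> True).
by exists N => x; rewrite inE; apply/NE.
Qed.

Lemma image_factorization U V (f : {linear U -> V}) :
  exists (N : submodClosed V) (p : {linear U -> submod N}),
    (forall y, exists u, p u = y) /\ forall u, val (p u) = f u.
Proof.
have [T TE] := full_submod U; have [N NE] := image_submod f T.
have [u|p pE] := @corestrict _ _ N f; first by apply/NE; exists u; rewrite ?TE.
exists N, p; split=> // -[v Nv]; have [u _ fu] := (NE v).1 Nv.
by exists u; apply: val_inj; rewrite pE.
Qed.

Lemma pi_quotmodP V (N : submodClosed V) x :
  \pi_(quotmod N) x = 0 <-> x \in N.
Proof. by rewrite -pi_quotmod_eq0; split=> /eqP. Qed.

Lemma pi_quotmod_surj V (N : submodClosed V) (y : quotmod N) :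
  exists x, \pi_(quotmod N) x = y.
Proof. by exists (repr y); rewrite reprK. Qed.

Lemma annihilatorP V (x : V) (a : A^o) :
  a \in annihilator x <-> (a : A) *: x = 0.
Proof. by rewrite unfold_in; split=> /eqP. Qed.

(** Zorn's lemma.  The last clause is maximality of M, applied to the submodule
generated by M and y. *)
Lemma maximal_avoiding V (D : V -> Prop) (N : submodClosed V) :
  (forall x, x \in N -> ~ D x) ->
  exists M : submodClosed V,
    [/\ {subset N <= M}, forall x, x \in M -> ~ D x
      & forall y, y \notin M -> exists x a, x \in M /\ D (x + a *: y)].
Proof.
move=> ND.
(* Zorn_bigcup also considers the empty chain, whose union is empty: hence the
   submodule attached to a set X is X `|` N rather than X. *)
pose good (X : set V) := exists M : submodClosed V,
  (forall x, x \in M <-> X x \/ x \in N) /\ forall x, x \in M -> ~ D x.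
have [F goodF totF|X [[M [ME MD]] Xmax]] := @Zorn_bigcup V good.
  pose U x := (\bigcup_(X in F) X)%classic x \/ x \in N.
  have UP2 x y : U x -> U y -> exists M : submodClosed V,
      [/\ x \in M, y \in M & forall z, z \in M -> U z].
    have inU X M : F X -> (forall x, x \in M <-> X x \/ x \in N) ->
        forall z : V, z \in M -> U z.
      by move=> FX ME z /ME[Xz|Nz]; [left; exists X|right].
    case=> [[X FX Xx]|Nx] [[Y FY Yy]|Ny].
    - have [XY|YX] := totF _ _ FX FY.
        have [M [ME _]] := goodF _ FY; exists M.
        by split; [apply/ME; left; apply: XY|apply/ME; left|apply: inU FY ME].
      have [M [ME _]] := goodF _ FX; exists M.
      by split; [apply/ME; left|apply/ME; left; apply: YX|apply: inU FX ME].
    - have [M [ME _]] := goodF _ FX; exists M.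
      by split; [apply/ME; left|apply/ME; right|apply: inU FX ME].
    - have [M [ME _]] := goodF _ FY; exists M.
      by split; [apply/ME; right|apply/ME; left|apply: inU FY ME].
    by exists N; split=> // z Nz; right.
  have [|x y Ux Uy|a x Ux|M ME] := @submod_of_propP A V U.
  - by right; apply: rpred0.
  - by have [M [Mx My]] := UP2 _ _ Ux Uy; apply; rewrite rpredD.
  - by have [M [Mx _]] := UP2 _ _ Ux Ux; apply; rewrite rpredZ.
  exists M; split=> // x /ME[[X FX Xx]|]; last exact: ND.
  by have [P [PE]] := goodF _ FX; apply; apply/PE; left.
exists M; split=> // [x Nx|y My]; first by apply/ME; right.
apply: contrapT => noD.
have [|u v [x [a [Mx ->]]] [z [b [Mz ->]]]|c u [x [a [Mx ->]]]|P PE] :=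
    @submod_of_propP A V (fun z => exists x a, x \in M /\ z = x + a *: y).
- by exists 0, 0; rewrite rpred0 scale0r addr0.
- by exists (x + z), (a + b); rewrite rpredD // scalerDl addrACA.
- by exists (c *: x), (c * a); rewrite rpredZ // scalerDr scalerA.
have MP x : x \in M -> x \in P.
  by move=> Mx; apply/PE; exists x, 0; rewrite scale0r addr0.
apply: (Xmax [set x | x \in P]%classic).
  split=> [x Xx|PX]; first by apply/MP/ME; left.
  case/negP: My; apply/ME; left; apply: PX; apply/PE.
  by exists 0, 1; rewrite rpred0 scale1r add0r.
exists P; split=> [x|x /PE[z [a [Mz ->]]] Dx].
  split=> [|[//|Nx]]; first by left.
  by apply/MP/ME; right.
by apply: noD; exists z, a.
Qed.

End LinearMaps.

(** * Simple modules and maximal ideals *)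

Section SimpleModules.
Variable A : pzRingType.
Implicit Types (U V M S E : lmodType A).

Lemma scale_regular1 (a : A^o) : (a : A) *: (1 : A^o) = a.
Proof. exact: mulr1. Qed.

Lemma zero_map_lifts M (I : submodClosed A^o) (f : {linear M -> quotmod I}) :
  (forall x, f x = 0) ->
  exists g : {linear M -> A^o}, forall x, f x = \pi_(quotmod I) (g x).
Proof.
move=> f0; have [|z z0] := @linear_of_fun A M A^o (fun=> 0).
  by move=> a x y; rewrite scaler0 addr0.
by exists z => x; rewrite f0 z0 linear0.
Qed.

Lemma maximal_ideal_above (N : submodClosed A^o) :
  (1 : A^o) \notin N ->
  exists M : submodClosed A^o, maximal_submod M /\ {subset N <= M}.
Proof.
move=> N1; have [x Nx x1|M [NM M1 Mmax]] := @maximal_avoiding A A^o (eq^~ 1) N.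
  by rewrite x1 (negPf N1) in Nx.
exists M; split=> //; split=> [MT|P MP].
  by apply: (M1 1) => //; rewrite MT.
have [PM|] := pselect {subset P <= M};
  first by left=> x; apply/idP/idP; [apply: PM|apply: MP].
move=> /existsNP[y /not_implyP[Py /negP My]]; right=> z; rewrite inE.
have [x [a [Mx xa1]]] := Mmax y My.
have P1 : (1 : A^o) \in P.
  by rewrite -xa1; apply: rpredD; [apply: MP|apply: rpredZ].
by rewrite -[z]scale_regular1 rpredZ.
Qed.

Lemma simple_quotmod V (N : submodClosed V) :
  maximal_submod N -> simple_module (quotmod N).
Proof.
move=> [NT Nmax]; split.
  apply: contrapT => no; apply: NT => x; rewrite inE -pi_quotmod_eq0.
  by apply/negPn/negP => nz; apply: no; exists (\pi_(quotmod N) x).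
move=> Q; have [P PE] := preimage_submod \pi_(quotmod N) Q.
have [x Nx|PN|PT] := Nmax P.
- by apply/PE; move/pi_quotmodP: Nx => /= ->; rewrite rpred0.
- left=> y; have [x <-] := pi_quotmod_surj y.
  by rewrite inE pi_quotmod_eq0 -PN; apply/idP/idP => /PE.
right=> y; have [x <-] := pi_quotmod_surj y.
by rewrite inE; apply/PE; rewrite PT.
Qed.

Lemma simple_surj M S (f : {linear M -> S}) x :
  simple_module S -> f x != 0 -> forall y, exists z, f z = y.
Proof.
move=> [_ Ssub] fx y; have [T TE] := full_submod M.
have [N NE] := image_submod f T; have [N0|NT] := Ssub N.
  by case/negP: fx; rewrite -[_ == 0]N0; apply/NE; exists x; rewrite ?TE.
by have /NE[z _ <-] : y \in N; [rewrite NT|exists z].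
Qed.

Lemma maximal_ker M S (f : {linear M -> S}) (N : submodClosed M) x :
  simple_module S -> f x != 0 -> (forall y, y \in N <-> f y = 0) ->
  maximal_submod N.
Proof.
move=> [_ Ssub] fx NE; split=> [NT|P NP].
  by case/eqP: fx; apply/NE; rewrite NT.
have [Q QE] := image_submod f P; have [Q0|QT] := Ssub Q.
  left=> y; apply/idP/idP => [Py|/NP//]; apply/NE/eqP.
  by rewrite -[_ == 0]Q0; apply/QE; exists y.
right=> y; rewrite inE; have /QE[z Pz fz] : f y \in Q by rewrite QT.
rewrite -(subrK z y) rpredD // NP //; apply/NE.
by rewrite linearB /= fz subrr.
Qed.

Lemma map_to_simple_eq0 M S (f : {linear M -> S}) :
  jacobson_rad M =i predT -> simple_module S -> forall x, f x = 0.
Proof.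
move=> radM simS x; have [N NE] := ker_submod f.
have [//|fx] := eqVneq (f x) 0; apply/NE.
have : x \in jacobson_rad M by rewrite radM.
by move=> /asboolP; apply; exact: maximal_ker simS fx NE.
Qed.

Lemma full_rad_of_maps_to_simple M :
  (forall S (f : {linear M -> S}), simple_module S -> forall x, f x = 0) ->
  jacobson_rad M =i predT.
Proof.
move=> M0 x; rewrite inE; apply/asboolP => N Nmax.
exact/pi_quotmodP/(M0 _ \pi_(quotmod N))/simple_quotmod.
Qed.

(** A simple module is A/I, where I is the annihilator of any nonzero element s,
through a |-> a s; the lift g is thus read directly as f = (g _) s. *)
Lemma max_projective_lift_simple M S (f : {linear M -> S}) (s : S) :
  max_projective M -> simple_module S -> s != 0 ->
  exists g : {linear M -> A^o}, forall x, f x = (g x : A) *: s.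
Proof.
move=> projM simS s0; have [r rE] := orbit_map s.
have r1 : r 1 != 0 by rewrite rE scale1r.
have rsurj := simple_surj simS r1.
have kerr a : a \in annihilator s <-> r a = 0 by rewrite annihilatorP rE.
have maxI := maximal_ker simS r1 kerr.
have [|h hE] := @factor_through_surjection _ _ _ _ r
  \pi_(quotmod (annihilator s)) rsurj.
  by move=> a ra; apply/pi_quotmodP/kerr.
have [g gE] := projM _ maxI (h \o f); exists g => x.
have [a fx] := rsurj (f x); rewrite -rE -fx; apply/eqP.
rewrite -subr_eq0 -linearB; apply/eqP/kerr/pi_quotmodP.
by rewrite linearB /= -gE /= -fx hE subrr.
Qed.

(** The identity of S factors as S -> A -> S, so S inherits projectivity
from A. *)
Lemma simple_max_projective S :
  simple_module S -> max_projective S -> projective_module S.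
Proof.
move=> simS projS U V p f psurj; have [[s s0] _] := simS.
have [g gE] := @max_projective_lift_simple S S idfun s projS simS s0.
have [u pu] := psurj (f s); have [r rE] := orbit_map u.
by exists (r \o g) => x /=; rewrite rE linearZ /= pu -linearZ -gE.
Qed.

(** A nonzero P meeting I trivially satisfies I + P = A since I is maximal.  If
1 = i + e accordingly, then a |-> a e kills I, and it induces a section A/I -> A
of the projection. *)
Lemma lifts_mod_non_essential M (I : submodClosed A^o) :
  maximal_submod I -> ~ essential_submod I -> lifts_mod M I.
Proof.
move=> [_ Imax] /existsNP[P] /not_implyP[IP0] /existsNP[p].
move=> /not_implyP[Pp p0] f.
have [|_ _ [i [x [Ii Px ->]]] [j [y [Ij Py ->]]]|a _ [i [x [Ii Px ->]]]|Q QE] :=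
    @submod_of_propP A A^o
      (fun z => exists i x, [/\ i \in I, x \in P & z = i + x]).
- by exists 0, 0; rewrite !rpred0 addr0.
- by exists (i + j), (x + y); rewrite !rpredD // addrACA.
- by exists (a *: i), (a *: x); rewrite !rpredZ // scalerDr.
have [z Iz|QI|QT] := Imax Q.
- by apply/QE; exists z, 0; rewrite rpred0 addr0.
- case: p0; apply: IP0 => //; rewrite -QI; apply/QE.
  by exists 0, p; rewrite rpred0 add0r.
have /QE[i [e [Ii Pe ie1]]] : (1 : A^o) \in Q by rewrite QT.
have [r rE] := @orbit_map A A^o e.
have ae (a : A^o) : r a = a - (a : A) *: i.
  by rewrite rE -[e](addKr i) -ie1 scalerDr scalerN addrC scale_regular1.
have [|g gE] := @factor_through_surjection _ _ _ _ \pi_(quotmod I) r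
  (@pi_quotmod_surj _ _ I).
  move=> a /pi_quotmodP Ia; apply: IP0; last by rewrite rE rpredZ.
  by rewrite ae submodB ?rpredZ.
exists (g \o f) => x /=; have [a <-] := pi_quotmod_surj (f x).
rewrite gE ae linearB /=; have /pi_quotmodP-> : (a : A) *: i \in I.
  by rewrite rpredZ.
by rewrite subr0.
Qed.

End SimpleModules.

(** * Singular modules over a nonsingular ring *)

Section SingularModules.
Variable A : pzRingType.
Implicit Types (U V M S E : lmodType A).

Lemma singularP V (x : V) :
  x \in singular_submod V <-> essential_submod (annihilator x).
Proof. by rewrite unfold_in; split=> /asboolP. Qed.

Lemma singularS U V (x : U) (y : V) :
  (forall a : A, a *: x = 0 -> a *: y = 0) ->
  x \in singular_submod U -> y \in singular_submod V.
Proof.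
move=> xy /singularP Ex; apply/singularP => P yP; apply: Ex => a /annihilatorP.
by move=> /xy/annihilatorP; apply: yP.
Qed.

Lemma singular_map U V (f : {linear U -> V}) x :
  x \in singular_submod U -> f x \in singular_submod V.
Proof. by apply: singularS => a ax; rewrite -linearZ ax linear0. Qed.

Lemma singular_surj U V (p : {linear U -> V}) :
  singular_module U -> (forall v, exists u, p u = v) -> singular_module V.
Proof.
by move=> sU psurj v; have [u <-] := psurj v; rewrite singular_map ?sU.
Qed.

Lemma singular_singular_submod E :
  singular_module (submod (singular_submod E)).
Proof.
move=> y; rewrite inE; apply: singularS (valP y) => a ay.
by apply: val_inj; rewrite linearZ.
Qed.

(** I annihilates the class of 1, which generates A/I. *)
Lemma singular_quotmod (I : submodClosed A^o) :
  essential_submod I -> singular_module (quotmod I).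
Proof.
move=> EI y; rewrite inE; have [x <-] := pi_quotmod_surj y.
rewrite -[x]scale_regular1 linearZ rpredZ //.
apply/singularP => P IP; apply: EI => a Ia.
apply: IP; apply/annihilatorP; rewrite -linearZ; apply/pi_quotmodP.
by rewrite scale_regular1.
Qed.

Definition nonsingular_ring :=
  forall x : A^o, x \in singular_submod A^o -> x = 0.

Lemma singular_to_ring M (g : {linear M -> A^o}) :
  nonsingular_ring -> singular_module M -> forall x, g x = 0.
Proof. by move=> nsA sM x; apply: nsA; rewrite singular_map ?sM. Qed.

(** A projective simple module embeds in A, where a singular module has
image 0. *)
Lemma singular_simple_not_projective M :
  nonsingular_ring -> singular_module M -> simple_module M ->
  ~ projective_module M.
Proof.
move=> nsA sM simM projM; have [[s s0] _] := simM.
have [r rE] := orbit_map s.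
have r1 : r 1 != 0 by rewrite rE scale1r.
have [g gE] := projM _ _ r idfun (simple_surj simM r1).
by case/eqP: s0; rewrite -[s]gE singular_to_ring // linear0.
Qed.

(** If b is in L and in an ideal that meets the annihilator of e trivially, then
the annihilator of b contains that of b e, so that b = 0 by nonsingularity.
This makes essential extensions of singular modules singular. *)
Lemma singular_of_essential E (e : E) (L : submodClosed A^o) :
  nonsingular_ring -> essential_submod L ->
  (forall a : A^o, a \in L -> (a : A) *: e \in singular_submod E) ->
  e \in singular_submod E.
Proof.
move=> nsA EL LeZ; apply/singularP => P eP; apply: EL => b Lb Pb; apply: nsA.
apply: singularS (LeZ b Lb) => a; rewrite scalerA => abe.
by apply: eP; [apply/annihilatorP|rewrite rpredZ].
Qed.

(** Let C be a complement of Z(E), that is, maximal with C and Z(E) meeting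
trivially.  The projection from Z(E) + C to Z(E) extends to h : E -> E by
injectivity.  As Z(E) + C is essential in E, each h x is sent into Z(E) by an
essential ideal, so it lies in Z(E) by nonsingularity. *)
Lemma singular_submod_summand E :
  nonsingular_ring -> injective_module E ->
  exists h : {linear E -> E}, (forall x, h x \in singular_submod E) /\
    forall x, x \in singular_submod E -> h x = x.
Proof.
move=> nsA injE; have [Z0 Z0E] := full_submod E.
pose Z := singular_submod E.
(* O is the zero submodule. *)
have [O OE] := ker_submod (@idfun E : {linear E -> E}).
have [x /OE/=->[]//|C [_ CZ Cmax]] :=
  @maximal_avoiding A E (fun x => x \in Z /\ x <> 0) O.
have CZ0 x : x \in C -> x \in Z -> x = 0.
  by move=> Cx Zx; apply: contrapT => x0; apply: (CZ x).
have addl : linear (fun w : submod Z * submod C => val w.1 + val w.2).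
  by move=> a u v; rewrite (linearP fst) (linearP snd) /= scalerDr addrACA.
have [i iE] := linear_of_fun addl.
have fl : linear (fun w : submod Z * submod C => val w.1).
  by move=> a u v; rewrite (linearP fst).
have [f fE] := linear_of_fun fl.
have [|h hE] := injE _ _ i f.
  move=> [z c] [z' c']; rewrite !iE /= => e.
  have d : val z - val z' = val c' - val c.
    rewrite -[val z](addrK (val c)) e addrAC.
    by rewrite [_ + val c']addrC addrK.
  have d0 : val z - val z' = 0.
    by apply: CZ0; [rewrite d|]; apply: submodB; apply: valP.
  congr (_, _); apply: val_inj; apply/eqP; first by rewrite -subr_eq0 d0.
  by rewrite eq_sym -subr_eq0 -d d0.
have hz x : x \in Z -> h x = x.
  by move=> Zx; have := hE (Submod Zx, 0); rewrite iE fE /= addr0.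
have hc x : x \in C -> h x = 0.
  by move=> Cx; have := hE (0, Submod Cx); rewrite iE fE /= add0r.
exists h; split=> // x.
have [|a b [z [c [Zz Cc ac]]] [w [d [Zw Cd bd]]]|b a [z [c [Zz Cc ac]]]|L LE] :=
  @submod_of_propP A A^o
    (fun a => exists z c, [/\ z \in Z, c \in C & (a : A) *: x = z + c]).
- by exists 0, 0; rewrite !rpred0 scale0r addr0.
- by exists (z + w), (c + d); rewrite !rpredD // scalerDl ac bd addrACA.
- by exists (b *: z), (b *: c); rewrite !rpredZ // -scalerDr -ac scalerA.
apply: (singular_of_essential nsA (L := L)); last first.
  move=> a /LE[z [c [Zz Cc ac]]].
  by rewrite -linearZ /= ac linearD /= hz // hc // addr0.
(* L is essential: if b x is not in C, maximality of C yields a with a b x in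
   Z + C, so that a b is in L and in P, hence is 0. *)
move=> P LP0 b Pb; have [Cbx|Cbx] := boolP ((b : A) *: x \in C).
  apply: LP0 => //; apply/LE; exists 0, ((b : A) *: x).
  by rewrite rpred0 add0r.
have [c [a [Cc [Zc c0]]]] := Cmax _ Cbx.
have ab0 : a *: b = 0.
  apply: LP0; last by rewrite rpredZ.
  apply/LE; exists (c + a *: ((b : A) *: x)), (- c); split=> //.
    by rewrite -sub0r submodB ?rpred0.
  by rewrite addrC addKr scalerA.
have ab0' : a *: ((b : A) *: x) = 0 by rewrite scalerA [a * b]ab0 scale0r.
by case: c0; rewrite ab0' addr0 in Zc *; apply: CZ0.
Qed.

End SingularModules.

(** * Injective modules *)

Section InjectiveModules.
Variable A : pzRingType.
Implicit Types (U V M E : lmodType A).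

Lemma injective_retract E M (i : {linear M -> E}) (r : {linear E -> M}) :
  injective_module E -> cancel i r -> injective_module M.
Proof.
move=> injE iK U V j f injj; have [g gE] := injE U V j (i \o f) injj.
by exists (r \o g) => u /=; rewrite gE /= iK.
Qed.

(** Extensions of f are handled through their graphs: submodules of V * M that
contain the graph of f and avoid the pairs (0, m) with m != 0.  A maximal one is
the graph of a total map, since the hypothesis provides a value at any v outside
the domain. *)
Lemma baer_criterion M :
  (forall (I : submodClosed A^o) (f : {linear submod I -> M}),
    exists m, forall a : submod I, f a = (val a : A) *: m) ->
  injective_module M.
Proof.
move=> baerM U V i f injI.
have [|b _ [u ->] [w ->]|a _ [u ->]|G GE] := @submod_of_propP A (V * M)%type
  (fun w => exists u, w = (i u, f u)).
- by exists 0; rewrite !linear0.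
- by exists (u + w); rewrite !linearD.
- by exists (a *: u); rewrite !linearZ.
have [w /GE[u ->] /= [iu0 []]|H [GH HD Hmax]] :=
    @maximal_avoiding A (V * M)%type (fun w => w.1 = 0 /\ w.2 <> 0) G.
  by have -> : u = 0; [apply: injI; rewrite iu0 linear0|rewrite linear0].
have H0 w : w \in H -> w.1 = 0 -> w.2 = 0.
  by move=> Hw w1; apply: contrapT => w2; apply: (HD w).
pose p : {linear submod H -> V} := fst \o \val.
pose q : {linear submod H -> M} := snd \o \val.
have kerp w : p w = 0 -> q w = 0 by apply: H0; apply: valP.
suff psurj v : exists w, p w = v.
  have [h hE] := factor_through_surjection psurj kerp; exists h => u.
  have Hu : (i u, f u) \in H by apply/GH/GE; exists u.
  exact: hE (Submod Hu).
(* I is the ideal of the scalars a with a v in the domain of the graph H. *)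
have [I IE] : exists I : submodClosed A^o,
    forall a, a \in I <-> exists m, ((a : A) *: v, m) \in H.
  apply: submod_of_propP => [|a b [m am] [n bn]|b a [m am]].
  - by exists 0; rewrite scale0r; apply: rpred0.
  - by exists (m + n); rewrite scalerDl; apply: (rpredD am bn).
  - by exists (b *: m); rewrite -scalerA; apply: (rpredZ b am).
have /choice[k kH] : forall a : submod I, exists m, ((val a : A) *: v, m) \in H.
  by move=> a; apply/IE/valP.
have kP (a : submod I) m : ((val a : A) *: v, m) \in H -> m = k a.
  move=> am; apply/eqP; rewrite -subr_eq0; apply/eqP.
  by apply: (H0 _ (submodB am (kH a))); rewrite /= subrr.
have [|kf kfE] := @linear_of_fun A (submod I) M k.
  move=> a x y; apply/esym/kP.
  rewrite linearP scalerDl -scalerA; exact: rpredD (rpredZ a (kH x)) (kH y).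
(* m is a value that the partial map can consistently take at v. *)
have [m mE] := baerM I kf.
have [Hvm|Hvm] := boolP ((v, m) \in H); first by exists (Submod Hvm).
have [[x y] [a [Hxy /= [xav yam]]]] := Hmax _ Hvm.
have xE : x = (- a) *: v by rewrite scaleNr; apply/eqP; rewrite -addr_eq0 xav.
have Ia : (- a : A^o) \in I by apply/IE; exists y; rewrite -xE.
case: yam; rewrite (@kP (Submod Ia) y) -?kfE ?mE /= -?xE //.
by rewrite scaleNr addNr.
Qed.

End InjectiveModules.

(** * Hereditary rings *)

Section Hereditary.
Variables (A : pzRingType).
Hypothesis hered : forall I : submodClosed A^o, projective_module (submod I).
Implicit Types (U V M S E : lmodType A).

(** Projectivity of the ideals reduces the test maps of Baer's criterion from M
to E. *)
Lemma hereditary_injective_quotient E M (p : {linear E -> M}) :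
  injective_module E -> (forall y, exists x, p x = y) -> injective_module M.
Proof.
move=> injE psurj; apply: baer_criterion => I f.
have [f' f'E] := hered f psurj.
have [g gE] := injE _ _ (\val : {linear submod I -> A^o}) f' val_inj.
exists (p (g 1)) => a.
by rewrite -f'E -gE -[X in g X]scale_regular1 !linearZ.
Qed.

(** The map a |-> a x onto the principal ideal of x splits; the image of the
section meets the annihilator of x trivially, so it is 0 if that annihilator is
essential. *)
Lemma hereditary_nonsingular : nonsingular_ring A.
Proof.
move=> x /singularP Ex; have [r rE] := @orbit_map A A^o x.
have [N [p [psurj pE]]] := image_factorization r.
have [g gK] := hered (idfun : {linear submod N -> submod N}) psurj.
have [T TE] := full_submod (submod N).
have [P PE] := image_submod g T.
have P0 : forall a, a \in P -> a = 0.
  apply: Ex => a /annihilatorP nx /PE[n _ gn]; rewrite -gn in nx *.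
  rewrite -rE -pE gK in nx; have -> : n = 0 by apply: val_inj; rewrite nx.
  by rewrite linear0.
have g0 n : g n = 0 by apply: P0; apply/PE; exists n; rewrite ?TE.
have p0 (n : submod N) : n = 0 by rewrite -[n]gK g0 linear0.
by rewrite -[x](scale1r (x : A^o)) -rE -pE (p0 (p 1)).
Qed.

Lemma injective_singular_submod E :
  injective_module E -> injective_module (submod (singular_submod E)).
Proof.
move=> injE.
have [h [hZ hK]] := singular_submod_summand hereditary_nonsingular injE.
have [r rE] := corestrict hZ.
apply: (injective_retract (i := \val) (r := r) injE).
by move=> x; apply: val_inj; rewrite rE hK //; apply: valP.
Qed.

Lemma singular_complement E :
  injective_module E ->
  exists F : submodClosed E, internal_direct_sum (singular_submod E) F.
Proof.
move=> injE.
have [h [hZ hK]] := singular_submod_summand hereditary_nonsingular injE.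
have [F FE] := ker_submod h; exists F; split=> [x|x Zx /FE].
  exists (h x), (x - h x); split; rewrite ?subrKC //.
  by apply/FE; rewrite linearB /= (hK (h x)) ?subrr.
by rewrite hK.
Qed.

(** The image K of f is injective, so it is a summand of A/I and has a generator
k.  If f were nonzero, K = A/ann(k) would have a simple quotient, and so would
E, against the fullness of its radical. *)
Lemma injective_map_to_cyclic_eq0 E (I : submodClosed A^o)
    (f : {linear E -> quotmod I}) :
  injective_module E -> jacobson_rad E =i predT -> forall x, f x = 0.
Proof.
move=> injE radE x; apply/eqP/negPn/negP => fx.
have [K [p [psurj pE]]] := image_factorization f.
have injK := hereditary_injective_quotient injE psurj.
have [r rK] := injK _ _ (\val : {linear submod K -> quotmod I}) idfun val_inj.
pose k := r (\pi_(quotmod I) 1).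
have kgen (y : submod K) : exists a : A, a *: k = y.
  have [a aE] := pi_quotmod_surj (val y); exists a.
  by rewrite -linearZ -linearZ scale_regular1 /= aE rK.
have [|M [maxM kM]] := @maximal_ideal_above A (annihilator k).
  apply/negP => /annihilatorP; rewrite scale1r => k0.
  case/eqP: fx; rewrite -pE; have [a <-] := kgen (p x).
  by rewrite k0 scaler0 linear0.
have simM := simple_quotmod maxM.
have [o oE] := orbit_map k.
have [y|a oa|h hE] := @factor_through_surjection A _ _ _ o \pi_(quotmod M).
- by have [a <-] := kgen y; exists a; rewrite oE.
- by apply/pi_quotmodP/kM/annihilatorP; rewrite -oE.
case: (maxM) => MT _; apply: MT => a; rewrite inE; apply/pi_quotmodP.
rewrite -hE; have [z <-] := psurj (o a).
exact: (map_to_simple_eq0 (h \o p) radE simM).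
Qed.

End Hereditary.

Theorem theorem2 (R : pzRingType) (hR : right_hereditary R) :
  [<-> (* (1) *)
       right_max_QF R;
       (* (2) *)
       forall S : rmodType R,
         simple_module S -> injective_module S -> projective_module S;
       (* (3) *)
       forall E : rmodType R,
         singular_module E -> injective_module E -> ring_projective E;
       (* (4) *)
       forall E : rmodType R,
         singular_module E -> injective_module E -> max_projective E;
       (* (5) *)
       forall E : rmodType R,
         singular_module E -> injective_module E -> jacobson_rad E =i predT;
       (* (6) *)
       forall E : rmodType R, injective_module E ->
         (exists F : submodClosed E, internal_direct_sum (singular_submod E) F) /\
         jacobson_rad (submod (singular_submod E)) =i predT].
Proof.
have nsR := hereditary_nonsingular hR; tfae.
- by move=> QF S simS injS; apply/(simple_max_projective simS)/QF.
- move=> simple_proj E singE injE.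
  have radE : jacobson_rad E =i predT.
    apply: full_rad_of_maps_to_simple => S f simS x; apply: contrapT => /eqP fx.
    have fsurj := simple_surj simS fx.
    have singS := singular_surj singE fsurj.
    apply: (singular_simple_not_projective nsR singS simS).
    exact/(simple_proj _ simS)/(hereditary_injective_quotient hR injE fsurj).
  move=> I f; apply: zero_map_lifts.
  exact: (injective_map_to_cyclic_eq0 hR f injE radE).
- by move=> ringproj E singE injE I _; apply: ringproj.
- move=> maxproj E singE injE; apply: full_rad_of_maps_to_simple => S f simS x.
  have [//|s0] := eqVneq (f x) 0.
  have [g ->] := max_projective_lift_simple f (maxproj E singE injE) simS s0.
  by rewrite singular_to_ring // scale0r.
- move=> rad_full E injE; split; first exact: singular_complement.
  apply: rad_full; first exact: singular_singular_submod.
  exact: injective_singular_submod.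
move=> split_rad E injE I maxI f.
have simI := simple_quotmod maxI.
have [EI|nEI] := pselect (essential_submod I); last first.
  exact: lifts_mod_non_essential.
apply: zero_map_lifts => x; apply: contrapT => /eqP fx.
have injI := hereditary_injective_quotient hR injE (simple_surj simI fx).
have [_ radZ] := split_rad _ injI.
have Zfx : f x \in singular_submod (quotmod I) by rewrite singular_quotmod.
case/eqP: fx; exact: (map_to_simple_eq0
  (\val : {linear submod (singular_submod (quotmod I)) -> quotmod I})
  radZ simI (Submod Zfx)).
Qed.
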